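(* Let $I\subseteq\mathbb{R}$ be an open interval, let $K$ be $\mathbb{R}$ or $\mathbb{C}$, and let $B, C, R : I\to K$ be functions. Let $P,Q: I\to K$ be functions, with $Q$ differentiable, such that for all $x\in I$ $$P(x)+Q(x)=B(x),\qquad Q'(x)=Q(x)^2-B(x)Q(x)+C(x).$$ Put $$g(x)=e^{\int P(x)\,dx},\qquad h(x)=e^{\int Q(x)\,dx}.$$ Assume that the indefinite integrals $\int P(x)\,dx$ and $\int g(x)R(x)\,dx$ exist on $I$. Then the general solution on $I$ of the differential equation $$y''+B(x)y'+C(x)y=R(x)$$ is $$y=\frac{1}{h(x)}\int\frac{h(x)}{g(x)}\left(\int g(x)R(x)\,dx\right)dx+\frac{C_1}{h(x)}\int\frac{h(x)}{g(x)}\,dx+\frac{C_2}{h(x)},$$ where $C_1,C_2\in K$ are arbitrary constants; that is, a twice differentiable function $y:I\to K$ satisfies the differential equation on $I$ if and only if it has this form for some $C_1,C_2\in K$.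
   Context: An indefinite integral $\int u(x)\,dx$ of a function $u$ on $I$ denotes one fixed (arbitrarily chosen) antiderivative of $u$ on $I$, i.e. a differentiable function $U$ with $U'=u$ on $I$; each time the same integral occurs the same antiderivative is used. The arbitrary constants of integration are displayed explicitly as $C_1,C_2$. The functions $g$ and $h$ are called the first and second integrating factors. *)

(* Defs.v *)
From Stdlib Require Import Reals.
From Coquelicot Require Import Coquelicot.

Variant scalar_field := RealField | ComplexField.

(* Both fields are viewed as normed spaces over the reals, so that [is_derive]
   is the derivative with respect to a real variable; in particular the complex
   case uses [C_R_NormedModule], not the (default) complex structure on [C]. *)
Definition carrier (K : scalar_field) : NormedModule R_AbsRing :=
  match K with
  | RealField => R_NormedModule
  | ComplexField => C_R_NormedModule
  end.

Coercion carrier : scalar_field >-> NormedModule.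

Definition kmult {K : scalar_field} : K -> K -> K :=
  match K with
  | RealField => Rmult
  | ComplexField => Cmult
  end.

Definition kone {K : scalar_field} : K :=
  match K with
  | RealField => R1
  | ComplexField => RtoC R1
  end.

Definition kinv {K : scalar_field} : K -> K :=
  match K with
  | RealField => Rinv
  | ComplexField => Cinv
  end.

Definition kdiv {K : scalar_field} (u v : K) : K := kmult u (kinv v).

(* exp (s + i t) = exp s * (cos t + i sin t) *)
Definition Cexp (z : C) : C :=
  (exp (Re z) * cos (Im z), exp (Re z) * sin (Im z))%R.

Definition kexp {K : scalar_field} : K -> K :=
  match K with
  | RealField => exp
  | ComplexField => Cexp
  end.

Declare Scope K_scope.
Delimit Scope K_scope with K.
Bind Scope K_scope with carrier.
Notation "u + v" := (plus u v) : K_scope.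
Notation "u - v" := (minus u v) : K_scope.
Notation "u * v" := (kmult u v) : K_scope.
Notation "u / v" := (kdiv u v) : K_scope.
Notation "u ^ 2" := (kmult u u) (at level 30) : K_scope.
Notation "1" := kone : K_scope.

Definition in_open_Rbar_interval (a b : Rbar) (x : R) : Prop :=
  Rbar_lt a x /\ Rbar_lt x b.

(* A function on an open interval I is encoded by a total function of which only
   the values on I matter; since I is open, derivatives at points of I do not
   depend on the values outside I. *)
Definition derivative_on {K : scalar_field} (I : R -> Prop) (f f' : R -> K) :=
  forall x, I x -> is_derive f x (f' x).

Definition antiderivative_on {K : scalar_field} (I : R -> Prop) (u U : R -> K) :=
  derivative_on I U u.

(* [y] is twice differentiable on I and y'' + B y' + C y = F there *)
Definition solution_on {K : scalar_field} (I : R -> Prop) (B C F y : R -> K) :=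
  exists y' y'' : R -> K,
    derivative_on I y y' /\ derivative_on I y' y'' /\
    forall x, I x -> (y'' x + B x * y' x + C x * y x = F x)%K.

(* Main.v *)
(** The Riccati equation says exactly that D^2 + B D + C = (D + P)(D + Q), so the
    equation is equivalent to the pair of first-order linear equations
    z' + P z = R and y' + Q y = z. Each is solved by its integrating factor: g z
    is an antiderivative of g R, and h y is an antiderivative of
    h z = (h / g) (int g R + C1). *)

Require Import Defs.
From Stdlib Require Import Reals Classical.
From Coquelicot Require Import Coquelicot.

(** * Intervals, and complex derivatives by components *)

Lemma in_open_Rbar_interval_open (a b : Rbar) : open (in_open_Rbar_interval a b).
Proof. apply open_and; [apply open_Rbar_gt | apply open_Rbar_lt]. Qed.

Lemma in_open_Rbar_interval_convex (a b : Rbar) (x y t : R) :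
  in_open_Rbar_interval a b x -> in_open_Rbar_interval a b y ->
  (x <= t <= y)%R -> in_open_Rbar_interval a b t.
Proof.
  intros [hx _] [_ hy] [hxt hty]; split.
  - now apply (Rbar_lt_le_trans a x t).
  - now apply (Rbar_le_lt_trans t y b).
Qed.

(** Both projections and the pairing map are real-linear, so the chain rule carries derivatives
    either way. This reduces the complex case to real calculus. *)
Lemma is_derive_C (f : R -> C) (x : R) (l : C) :
  is_derive (f : R -> C_R_NormedModule) x l <->
  is_derive (fun t => fst (f t)) x (fst l) /\
  is_derive (fun t => snd (f t)) x (snd l).
Proof.
  split.
  - intros hf; split.
    + eapply filterdiff_ext_lin;
        [apply (filterdiff_comp' (V := C_R_NormedModule) (W := R_NormedModule) f fst x
          _ fst hf), filterdiff_linear, is_linear_fst | reflexivity].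
    + eapply filterdiff_ext_lin;
        [apply (filterdiff_comp' (V := C_R_NormedModule) (W := R_NormedModule) f snd x
          _ snd hf), filterdiff_linear, is_linear_snd | reflexivity].
  - intros [h1 h2].
    apply (is_derive_ext (fun t => (fst (f t), snd (f t)) : C_R_NormedModule)).
    { intros t; symmetry; apply surjective_pairing. }
    eapply filterdiff_ext_lin.
    + apply (filterdiff_comp_2 (U := R_NormedModule) (V := R_NormedModule)
        (W := C_R_NormedModule) _ _ pair _ _ pair h1 h2).
      apply (filterdiff_linear (V := prod_NormedModule _ R_NormedModule R_NormedModule)).
      apply is_linear_prod; [apply is_linear_fst | apply is_linear_snd].
    + reflexivity.
Qed.

(* [ring] looks up the type of a term syntactically, and the type of [plus u v]
   or [opp u] is a projection of a canonical structure rather than [K] itself. *)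
Definition kplus {K : scalar_field} (u v : K) : K := plus u v.
Definition kopp {K : scalar_field} (u : K) : K := opp u.
Definition kminus {K : scalar_field} (u v : K) : K := minus u v.
Definition kzero {K : scalar_field} : K := zero.

(** * Arithmetic and the exponential, uniformly in the field *)

Section Scalars.

Context {K : scalar_field}.

Lemma scalar_ring_theory :
  ring_theory kzero kone kplus kmult kminus kopp (@eq K).
Proof.
  destruct K; constructor; intros; try reflexivity;
    [apply Rplus_0_l | apply Rplus_comm | symmetry; apply Rplus_assoc
    | apply Rmult_1_l | apply Rmult_comm | symmetry; apply Rmult_assoc
    | apply Rmult_plus_distr_r | apply Rplus_opp_r
    | apply Cplus_0_l | apply Cplus_comm | apply Cplus_assoc
    | apply Cmult_1_l | apply Cmult_comm | apply Cmult_assoc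
    | apply Cmult_plus_distr_r | apply Cplus_opp_r].
Qed.

Add Ring scalar_ring : scalar_ring_theory.

Ltac scalar_ring :=
  cbv beta;
  repeat match goal with
  | |- context [@minus ?G ?u ?v] => change (@minus G u v) with (kminus u v)
  | |- context [@plus ?G ?u ?v] => change (@plus G u v) with (kplus u v)
  | |- context [@opp ?G ?u] => change (@opp G u) with (kopp u)
  | |- context [@zero ?G] => change (@zero G) with (@kzero K)
  end;
  match goal with |- ?u = ?v => change (@eq K u v) end;
  ring.

Lemma kexp_plus (u v : K) : kexp (plus u v) = (kexp u * kexp v)%K.
Proof.
  destruct K; simpl in *; [apply exp_plus |].
  destruct u as [a b], v as [c d].
  unfold Cexp, Cmult, plus; simpl.
  rewrite exp_plus, cos_plus, sin_plus; f_equal; ring.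
Qed.

Lemma kexp_zero : kexp (zero : K) = kone.
Proof.
  destruct K; [exact exp_0 |].
  change (Cexp (0, 0)%R = RtoC 1); unfold Cexp; simpl.
  rewrite exp_0, cos_0, sin_0, Rmult_1_l, Rmult_0_r; reflexivity.
Qed.

Lemma kexp_opp_r (u : K) : (kexp u * kexp (opp u))%K = kone.
Proof. rewrite <- kexp_plus, <- kexp_zero; f_equal; apply (Ropp_def scalar_ring_theory). Qed.

(** The hypothesis itself forces [u] to be nonzero, since otherwise 0 = 1; cancelling [u] then gives
    the result. *)
Lemma kinv_unique (u v : K) : (u * v)%K = kone -> kinv u = v.
Proof.
  destruct K; simpl in *; intros huv.
  - assert (hu : u <> R0).
    { intros hu; rewrite hu, Rmult_0_l in huv; symmetry in huv.
      now apply R1_neq_R0. }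
    rewrite <- (Rmult_1_r (Rinv u)).
    change 1%R with R1; rewrite <- huv.
    rewrite <- Rmult_assoc, Rinv_l, Rmult_1_l; auto.
  - assert (hu : u <> RtoC 0).
    { intros hu; rewrite hu, Cmult_0_l in huv; injection huv; intros h.
      symmetry in h; now apply R1_neq_R0. }
    rewrite <- (Cmult_1_r (Cinv u)).
    change (RtoC 1) with (RtoC R1); rewrite <- huv.
    rewrite Cmult_assoc, Cinv_l, Cmult_1_l; auto.
Qed.

(** Turns every division by [g] or [h] into a product with an exponential, so the product rule takes
    the place of a quotient rule. *)
Lemma kinv_kexp (u : K) : kinv (kexp u) = kexp (opp u).
Proof. apply kinv_unique, kexp_opp_r. Qed.

(** * Differentiation rules *)

Lemma is_derive_kmult (f g : R -> K) (x : R) (df dg : K) :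
  is_derive f x df -> is_derive g x dg ->
  is_derive (fun t => (f t * g t)%K) x (df * g x + f x * dg)%K.
Proof.
  destruct K; intros hf hg.
  - apply (is_derive_mult (K := R_AbsRing) f g); auto; intros; apply Rmult_comm.
  (* The real and imaginary parts of a complex product are a difference and a sum of real products,
     each handled by the real Leibniz rule. *)
  - apply is_derive_C in hf as [f1 f2]; apply is_derive_C in hg as [g1 g2].
    apply is_derive_C; split.
    + evar_last;
        [apply (is_derive_minus (V := R_NormedModule));
         apply (is_derive_mult (K := R_AbsRing)); eauto using Rmult_comm |].
      simpl; unfold minus, plus, opp, mult; simpl; ring.
    + evar_last;
        [apply (is_derive_plus (V := R_NormedModule));
         apply (is_derive_mult (K := R_AbsRing)); eauto using Rmult_comm |].
      simpl; unfold minus, plus, opp, mult; simpl; ring.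
Qed.

Lemma is_derive_kexp (u : R -> K) (x : R) (du : K) :
  is_derive u x du -> is_derive (fun t => kexp (u t)) x (kexp (u x) * du)%K.
Proof.
  destruct K; intros hu.
  - evar_last; [apply (is_derive_comp exp u); [apply is_derive_exp | exact hu] |].
    apply Rmult_comm.
  - apply is_derive_C in hu as [u1 u2].
    apply is_derive_C; split; simpl.
    + evar_last.
      * apply (is_derive_mult (K := R_AbsRing)); [| | intros; apply Rmult_comm].
        -- apply (is_derive_comp exp (fun t => fst (u t))); [apply is_derive_exp | exact u1].
        -- apply (is_derive_comp cos (fun t => snd (u t))); [apply is_derive_cos | exact u2].
      * unfold plus, mult, scal, Re, Im; simpl; unfold mult; simpl; ring.
    + evar_last.
      * apply (is_derive_mult (K := R_AbsRing)); [| | intros; apply Rmult_comm].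
        -- apply (is_derive_comp exp (fun t => fst (u t))); [apply is_derive_exp | exact u1].
        -- apply (is_derive_comp sin (fun t => snd (u t))); [apply is_derive_sin | exact u2].
      * unfold plus, mult, scal, Re, Im; simpl; unfold mult; simpl; ring.
Qed.

(** * Constancy and antiderivatives on an interval *)

Lemma is_derive_zero_constant (a b : Rbar) (f : R -> K) :
  derivative_on (in_open_Rbar_interval a b) f (fun _ => zero) ->
  exists c, forall x, in_open_Rbar_interval a b x -> f x = c.
Proof.
  intros hf.
  (* The bounds are arbitrary, so the interval may be empty; otherwise a base point supplies the
     constant. *)
  destruct (classic (exists x0, in_open_Rbar_interval a b x0)) as [[x0 h0] | hempty].
  - exists (f x0); intros x hx.
    destruct (Rtotal_order x x0) as [hlt | [-> | hgt]]; trivial.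
    + apply eq_is_derive; trivial; intros t ht; apply hf.
      now apply (in_open_Rbar_interval_convex a b x x0).
    + symmetry; apply eq_is_derive; trivial; intros t ht; apply hf.
      now apply (in_open_Rbar_interval_convex a b x0 x).
  - exists zero; intros x hx; elim hempty; now exists x.
Qed.

(** Fundamental theorem of calculus: the integral from a base point is an antiderivative. *)
Lemma antiderivative_exists (a b : Rbar) (f : R -> K) :
  (forall x, in_open_Rbar_interval a b x -> continuous f x) ->
  exists F, antiderivative_on (in_open_Rbar_interval a b) f F.
Proof.
  intros hf.
  destruct (classic (exists x0, in_open_Rbar_interval a b x0)) as [[x0 h0] | hempty].
  - enough (hint : forall x, in_open_Rbar_interval a b x -> exists v, is_RInt f x0 x v).
    { assert (hF : exists F, forall x, in_open_Rbar_interval a b x -> is_RInt f x0 x (F x)).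
      (* [RInt] asks for a complete space, which [carrier] does not record, so each field names its
         own complete structure. *)
      { destruct K;
          [exists (RInt (V := R_CompleteNormedModule) f x0)
          | exists (RInt (V := C_R_CompleteNormedModule) f x0)];
          intros x hx; destruct (hint x hx) as [v hv].
        - apply (RInt_correct (V := R_CompleteNormedModule)); now exists v.
        - apply (RInt_correct (V := C_R_CompleteNormedModule)); now exists v. }
      destruct hF as [F hF]; exists F; intros x hx.
      apply (is_derive_RInt f F x0); auto.
      eapply filter_imp; [exact hF | now apply in_open_Rbar_interval_open]. }
    intros x hx.
    assert (hc : forall t, (Rmin x0 x <= t <= Rmax x0 x)%R -> continuous f t).
    { intros t ht; apply hf.
      destruct (Rle_or_lt x0 x) as [hle | hlt].
      - rewrite Rmin_left, Rmax_right in ht by assumption.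
        now apply (in_open_Rbar_interval_convex a b x0 x).
      - apply Rlt_le in hlt; rewrite Rmin_right, Rmax_left in ht by assumption.
        now apply (in_open_Rbar_interval_convex a b x x0). }
    destruct K;
      [apply (ex_RInt_continuous (V := R_CompleteNormedModule) f x0 x hc)
      | apply (ex_RInt_continuous (V := C_R_CompleteNormedModule) f x0 x hc)].
  - exists f; intros x hx; elim hempty; now exists x.
Qed.

(** * Linear equations of first and second order *)

(** The integrating factor e^u gives (e^u y)' = e^u (y' + p y) = e^u r = W', so e^u y and [W] differ
    by a constant. Conversely the formula is differentiated directly. *)
Lemma first_order_linear_solution (a b : Rbar) (p r u W y : R -> K) :
  let I := in_open_Rbar_interval a b in
  antiderivative_on I p u ->
  antiderivative_on I (fun x => kexp (u x) * r x)%K W ->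
  derivative_on I y (fun x => r x - p x * y x)%K <->
  exists c : K, forall x, I x -> y x = (kinv (kexp (u x)) * (W x + c))%K.
Proof.
  intros I hu hW; split.
  - intros hy.
    destruct (is_derive_zero_constant a b (fun x => kexp (u x) * y x - W x)%K)
      as [c hc].
    + intros x hx; evar_last.
      * apply is_derive_minus; [apply is_derive_kmult |].
        -- exact (is_derive_kexp u x _ (hu x hx)).
        -- exact (hy x hx).
        -- exact (hW x hx).
      * scalar_ring.
    + exists c; intros x hx; rewrite <- (hc x hx), kinv_kexp.
      (* [ring] treats e^u and e^(-u) as unrelated atoms, so their product is isolated and cancelled
         by hand. *)
      transitivity (kexp (u x) * kexp (opp (u x)) * y x)%K.
      * rewrite kexp_opp_r; scalar_ring.
      * scalar_ring.
  - intros [c hc] x hx.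
    (* The formula for [y] is known only on the interval; openness makes it valid near [x], which
       suffices for the derivative. *)
    apply (is_derive_ext_loc (fun t => kexp (opp (u t)) * (W t + c))%K).
    { eapply filter_imp; [| exact (in_open_Rbar_interval_open a b x hx)].
      intros t ht; simpl; rewrite hc by exact ht; now rewrite kinv_kexp. }
    evar_last.
    + apply is_derive_kmult.
      * apply (is_derive_kexp (fun t => opp (u t))), is_derive_opp, (hu x hx).
      * apply is_derive_plus; [exact (hW x hx) | apply is_derive_const].
    + rewrite hc, kinv_kexp by exact hx.
      transitivity (kexp (u x) * kexp (opp (u x)) * r x
        - p x * (kexp (opp (u x)) * (W x + c)))%K.
      * scalar_ring.
      * rewrite kexp_opp_r; scalar_ring.
Qed.

(** With z = y' + Q y one gets z' + P z = y'' + (P + Q) y' + (Q' + P Q) y, and the Riccati equation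
    with P = B - Q gives Q' + P Q = C. *)
Lemma solution_on_factorization (I : R -> Prop) (B C F P Q Q' y : R -> K) :
  derivative_on I Q Q' ->
  (forall x, I x -> (P x + Q x = B x)%K) ->
  (forall x, I x -> (Q' x = Q x ^ 2 - B x * Q x + C x)%K) ->
  solution_on I B C F y <->
  exists z : R -> K,
    derivative_on I z (fun x => F x - P x * z x)%K /\
    derivative_on I y (fun x => z x - Q x * y x)%K.
Proof.
  intros hQ hB hC; split.
  - intros (y' & y'' & hy & hy' & heq).
    exists (fun x => y' x + Q x * y x)%K; split; intros x hx.
    + evar_last.
      * apply is_derive_plus; [exact (hy' x hx) | apply is_derive_kmult].
        -- exact (hQ x hx).
        -- exact (hy x hx).
      * rewrite <- (heq x hx), (hC x hx), <- (hB x hx); scalar_ring.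
    + evar_last; [exact (hy x hx) | scalar_ring].
  - intros (z & hz & hy).
    exists (fun x => z x - Q x * y x)%K.
    (* This is (z - Q y)' with z' = F - P z and y' = z - Q y substituted. *)
    exists (fun x => F x - P x * z x - (Q' x * y x + Q x * (z x - Q x * y x)))%K.
    split; [exact hy | split]; intros x hx.
    + apply is_derive_minus; [exact (hz x hx) | apply is_derive_kmult].
      * exact (hQ x hx).
      * exact (hy x hx).
    + rewrite (hC x hx), <- (hB x hx); scalar_ring.
Qed.

Lemma derivative_on_continuous (I : R -> Prop) (f f' : R -> K) :
  derivative_on I f f' -> forall x, I x -> continuous f x.
Proof.
  intros hf x hx; apply ex_derive_continuous; exists (f' x); now apply hf.
Qed.

Lemma variation_of_constants (a b : Rbar)
  (B C F P Q Q' intP intgF intQ U V y : R -> K) :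
  let I := in_open_Rbar_interval a b in
  let g := fun x => kexp (intP x) in
  let h := fun x => kexp (intQ x) in
  derivative_on I Q Q' ->
  (forall x, I x -> (P x + Q x = B x)%K) ->
  (forall x, I x -> (Q' x = Q x ^ 2 - B x * Q x + C x)%K) ->
  antiderivative_on I P intP ->
  antiderivative_on I (fun x => g x * F x)%K intgF ->
  antiderivative_on I Q intQ ->
  antiderivative_on I (fun x => h x / g x * intgF x)%K U ->
  antiderivative_on I (fun x => h x / g x)%K V ->
  solution_on I B C F y <->
  exists C1 C2 : K, forall x, I x ->
    (y x = 1 / h x * U x + C1 / h x * V x + C2 / h x)%K.
Proof.
  intros I g h hQ hB hC hP hgF hintQ hU hV.
  rewrite (solution_on_factorization I B C F P Q Q' y hQ hB hC).
  (* By linearity, the constant from the inner integral passes through the outer one: [h] times z is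
     (h / g) intgF + C1 (h / g). *)
  assert (hW : forall (C1 : K) (z : R -> K),
    (forall x, I x -> z x = (kinv (g x) * (intgF x + C1))%K) ->
    antiderivative_on I (fun x => kexp (intQ x) * z x)%K
      (fun x => U x + C1 * V x)%K).
  { intros C1 z hz x hx; evar_last.
    - apply is_derive_plus; [exact (hU x hx) | apply is_derive_kmult].
      + apply is_derive_const.
      + exact (hV x hx).
    - rewrite hz by exact hx; unfold kdiv, h; scalar_ring. }
  split.
  + intros (z & hz & hy).
    apply (first_order_linear_solution a b P F intP intgF z hP hgF) in hz as [C1 hz].
    apply (first_order_linear_solution a b Q z intQ _ y hintQ (hW C1 z hz)) in hy
      as [C2 hy].
    exists C1, C2; intros x hx; rewrite (hy x hx); unfold kdiv, h; scalar_ring.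
  + intros (C1 & C2 & hy).
    set (z := fun x => (kinv (g x) * (intgF x + C1))%K).
    exists z; split.
    * apply (first_order_linear_solution a b P F intP intgF z hP hgF).
      now exists C1.
    * apply (first_order_linear_solution a b Q z intQ _ y hintQ
        (hW C1 z (fun _ _ => eq_refl))).
      exists C2; intros x hx; rewrite (hy x hx); unfold kdiv, h; scalar_ring.
Qed.

End Scalars.

(** The forcing term is written [F], as [R] denotes the reals. The integrals whose existence is
    concluded have differentiable, hence continuous, integrands; the solution formula is then proved
    for every choice of them. *)
Theorem theorem1 (K : scalar_field) (a b : Rbar)
  (B C F P Q Q' intP intgF : R -> K) :
  let I := in_open_Rbar_interval a b in
  let g := fun x => kexp (intP x) in
  derivative_on I Q Q' ->
  (forall x, I x -> (P x + Q x = B x)%K) ->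
  (forall x, I x -> (Q' x = Q x ^ 2 - B x * Q x + C x)%K) ->
  antiderivative_on I P intP ->
  antiderivative_on I (fun x => g x * F x)%K intgF ->
  (exists intQ : R -> K, antiderivative_on I Q intQ) /\
  (forall intQ : R -> K, antiderivative_on I Q intQ ->
   let h := fun x => kexp (intQ x) in
   (exists U : R -> K, antiderivative_on I (fun x => h x / g x * intgF x)%K U) /\
   (exists V : R -> K, antiderivative_on I (fun x => h x / g x)%K V) /\
   (forall U V : R -> K,
    antiderivative_on I (fun x => h x / g x * intgF x)%K U ->
    antiderivative_on I (fun x => h x / g x)%K V ->
    forall y : R -> K,
    solution_on I B C F y <->
    exists C1 C2 : K, forall x, I x ->
      (y x = 1 / h x * U x + C1 / h x * V x + C2 / h x)%K)).
Proof.
  intros I g hQ hB hC hP hgF.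
  split; [now apply antiderivative_exists, (derivative_on_continuous I Q Q') |].
  intros intQ hintQ h.
  (* Writing h / g as e^(intQ) e^(-intP) makes it differentiable even if [P] is discontinuous.
     Multiplying by the differentiable [intgF] covers the other integrand. *)
  assert (hhg : derivative_on I (fun x => h x / g x)%K
    (fun x => h x * Q x * kexp (opp (intP x))
      + h x * (kexp (opp (intP x)) * opp (P x)))%K).
  { intros x hx.
    apply (is_derive_ext (fun t => h t * kexp (opp (intP t)))%K).
    { intros t; unfold kdiv, g; now rewrite kinv_kexp. }
    apply (is_derive_kmult h (fun t => kexp (opp (intP t)))).
    - exact (is_derive_kexp intQ x _ (hintQ x hx)).
    - exact (is_derive_kexp (fun t => opp (intP t)) x _
        (is_derive_opp intP x _ (hP x hx))). }
  split; [| split].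
  - apply antiderivative_exists; intros x hx.
    apply ex_derive_continuous; eexists.
    apply is_derive_kmult; [exact (hhg x hx) | exact (hgF x hx)].
  - now apply antiderivative_exists, (derivative_on_continuous I _ _ hhg).
  - intros U V hU hV y.
    exact (variation_of_constants a b B C F P Q Q' intP intgF intQ U V y
      hQ hB hC hP hgF hintQ hU hV).
Qed.
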